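(* Let $R$ be a ring and $G$ be a group. If the group ring $RG$ is a UNC ring, then $R$ is a UNC ring and the hypercenter $H(G)$ is a $2$-group.
   Context: Rings are associative with identity, not necessarily commutative. An element $a$ of a ring $S$ is nil-clean if $a=e+b$ with $e^2=e\in S$ and $b\in S$ nilpotent ($e$ and $b$ need not commute). A ring $S$ is a UNC ring if every unit of $S$ is nil-clean. $RG$ is the group ring of $G$ over $R$. A group is a $2$-group if the order of each of its elements is a (finite) power of $2$. The hypercenter $H(G)$ is the union of the transfinite upper central series of $G$: $\mathcal Z_0(G)=1$, $\mathcal Z_{\beta+1}(G)/\mathcal Z_\beta(G)$ is the center of $G/\mathcal Z_\beta(G)$ for each ordinal $\beta$, and $\mathcal Z_\lambda(G)=\bigcup_{\beta<\lambda}\mathcal Z_\beta(G)$ for limit ordinals $\lambda$. *)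

(* Defs.v *)
From HB Require Import structures.
From mathcomp Require Import all_boot all_algebra.
From mathcomp Require Import finmap monalg wochoice.

Set Implicit Arguments.
Unset Strict Implicit.
Unset Printing Implicit Defensive.

Import GRing.Theory.
Local Open Scope fset_scope.
Local Open Scope ring_scope.

(* [{malg R[K]}] is the R-module of finitely supported functions K -> R, with  *)
(* basis [<< k >>]. The library gives it a product only when K is a monomType, *)
(* in which 1 is the only invertible element; here K is a group.               *)
Definition group_ring (R : nzRingType) (G : groupType) : Type := {malg R[G]}.

Section GroupRing.
Variables (R : nzRingType) (G : groupType).
Implicit Types (g : {malg R[G]}) (k : G).

Definition gr_one : {malg R[G]} := << 1 *g 1%g >>.

Definition gr_mul g1 g2 : {malg R[G]} :=
  \sum_(k1 <- msupp g1) \sum_(k2 <- msupp g2)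
    << g1@_k1 * g2@_k2 *g (k1 * k2)%g >>.

Lemma gr_mull (d1 d2 : {fset G}) g1 g2 :
  msupp g1 `<=` d1 -> msupp g2 `<=` d2 ->
  gr_mul g1 g2 =
    \sum_(k1 <- d1) \sum_(k2 <- d2) << g1@_k1 * g2@_k2 *g (k1 * k2)%g >>.
Proof.
move=> le_d1 le_d2; rewrite /gr_mul (big_fset_incl _ le_d1) /=.
  apply/eq_bigr=> k1 _; apply/big_fset_incl => // k _ /mcoeff_outdom ->.
  by rewrite mulr0 monalgU0.
move=> k _ /mcoeff_outdom g1k.
by rewrite big1 => // k' _; rewrite g1k mul0r monalgU0.
Qed.

Lemma gr_mul0g : left_zero 0 gr_mul.
Proof. by move=> g; rewrite /gr_mul msupp0 big_seq_fset0. Qed.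

Lemma gr_mulg0 : right_zero 0 gr_mul.
Proof.
by move=> g; rewrite /gr_mul msupp0 big1 // => k _; rewrite big_seq_fset0.
Qed.

Lemma gr_mulUg c k g :
  gr_mul << c *g k >> g = \sum_(k' <- msupp g) << c * g@_k' *g (k * k')%g >>.
Proof.
rewrite (gr_mull msuppU_le (fsubset_refl _)) big_seq_fset1.
by apply/eq_bigr => k' _; rewrite mcoeffUU.
Qed.

Lemma gr_mulgU c k g :
  gr_mul g << c *g k >> = \sum_(k' <- msupp g) << g@_k' * c *g (k' * k)%g >>.
Proof.
rewrite (gr_mull (fsubset_refl _) msuppU_le).
by apply/eq_bigr=> k' _; rewrite big_seq_fset1 mcoeffUU.
Qed.

Lemma gr_mulUU c1 c2 k1 k2 :
  gr_mul << c1 *g k1 >> << c2 *g k2 >> = << c1 * c2 *g (k1 * k2)%g >>.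
Proof. by rewrite (gr_mull msuppU_le msuppU_le) !big_seq_fset1 !mcoeffUU. Qed.

Lemma gr_mul1g : left_id gr_one gr_mul.
Proof.
move=> g; rewrite gr_mulUg [RHS]monalgE.
by apply/eq_bigr=> k _; rewrite mul1r mul1g.
Qed.

Lemma gr_mulg1 : right_id gr_one gr_mul.
Proof.
move=> g; rewrite gr_mulgU [RHS]monalgE.
by apply/eq_bigr=> k _; rewrite mulr1 mulg1.
Qed.

Lemma gr_mulDl : left_distributive gr_mul +%R.
Proof.
move=> g1 g2 g; rewrite (gr_mull (msuppD_le _ _) (fsubset_refl _)).
rewrite [X in _ = X + _](gr_mull (fsubsetUl _ (msupp g2)) (fsubset_refl _)).
rewrite [X in _ = _ + X](gr_mull (fsubsetUr (msupp g1) _) (fsubset_refl _)).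
rewrite -big_split /=; apply/eq_bigr=> k1 _.
rewrite -big_split /=; apply/eq_bigr=> k2 _.
by rewrite mcoeffD mulrDl monalgUD.
Qed.

Lemma gr_mulDr : right_distributive gr_mul +%R.
Proof.
move=> g g1 g2; rewrite (gr_mull (fsubset_refl _) (msuppD_le _ _)).
rewrite [X in _ = X + _](gr_mull (fsubset_refl _) (fsubsetUl _ (msupp g2))).
rewrite [X in _ = _ + X](gr_mull (fsubset_refl _) (fsubsetUr (msupp g1) _)).
rewrite -big_split /=; apply/eq_bigr=> k1 _.
rewrite -big_split /=; apply/eq_bigr=> k2 _.
by rewrite mcoeffD mulrDr monalgUD.
Qed.

Lemma gr_mulA : associative gr_mul.
Proof.
have suml g (I : Type) (r : seq I) (F : I -> {malg R[G]}) :
    gr_mul (\sum_(i <- r) F i) g = \sum_(i <- r) gr_mul (F i) g.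
  exact: (big_morph (gr_mul^~ g) (fun x y => gr_mulDl x y g) (gr_mul0g g)).
have sumr g (I : Type) (r : seq I) (F : I -> {malg R[G]}) :
    gr_mul g (\sum_(i <- r) F i) = \sum_(i <- r) gr_mul g (F i).
  exact: (big_morph (gr_mul g) (gr_mulDr g) (gr_mulg0 g)).
move=> g1 g2 g3; rewrite [g1]monalgE [g2]monalgE [g3]monalgE.
rewrite !suml; apply/eq_bigr=> k1 _.
rewrite [LHS]sumr [X in _ = gr_mul X _]sumr suml.
apply/eq_bigr=> k2 _; rewrite !sumr; apply/eq_bigr=> k3 _.
by rewrite !gr_mulUU mulrA mulgA.
Qed.

Lemma gr_oner_neq0 : gr_one != 0.
Proof. by rewrite monalgU_eq0 oner_eq0. Qed.

HB.instance Definition _ := GRing.Lmodule.copy (group_ring R G) {malg R[G]}.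
HB.instance Definition _ := GRing.Zmodule_isNzRing.Build (group_ring R G)
  gr_mulA gr_mul1g gr_mulg1 gr_mulDl gr_mulDr gr_oner_neq0.

End GroupRing.

Section UNC.
Variable S : pzRingType.
Implicit Types a b e u : S.

Definition idempotent_elt e := e ^+ 2 = e.

Definition nilpotent_elt b := exists n : nat, b ^+ n = 0.

Definition nil_clean a :=
  exists e b, [/\ idempotent_elt e, nilpotent_elt b & a = e + b].

Definition is_unit u := exists v, v * u = 1 /\ u * v = 1.

Definition UNC := forall u, is_unit u -> nil_clean u.

End UNC.

Section WellOrder.
Variables (W : eqType) (le : rel W).

Definition wo_lt (a b : W) := le a b && (a != b).

Definition wo_zero (b : W) := forall a, le b a.

Definition wo_succ (a b : W) :=
  wo_lt a b /\ forall c, wo_lt a c -> le b c.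

Definition wo_limit (b : W) :=
  ~ wo_zero b /\ forall a, ~ wo_succ a b.

Lemma well_order_chain : well_order le -> wo_chain le predT.
Proof. by move=> wo; apply: (withinW wo). Qed.

End WellOrder.

Section UpperCentralSeries.
Variable G : groupType.

(* Ordinals are represented by the elements of well-ordered types, an element  *)
(* standing for the order type of the set of its strict predecessors. As       *)
(* [[~ x, y] = (y * x)^-1 * (x * y)], the second clause says that the class of *)
(* x commutes with all classes modulo the a-th term.                           *)
Inductive upper_central (W : eqType) (le : rel W) : W -> G -> Prop :=
| UpperCentral0 b : wo_zero le b -> upper_central le b 1%g
| UpperCentralS a b x : wo_succ le a b ->
    (forall y : G, upper_central le a [~ x, y]%g) -> upper_central le b x
| UpperCentralL a b x : wo_limit le b -> wo_lt le a b ->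
    upper_central le a x -> upper_central le b x.

Lemma upper_central0 (W : eqType) (le : rel W) (b : W) (x : G) :
  well_order le -> wo_zero le b -> upper_central le b x <-> x = 1%g.
Proof.
move=> wo b0.
have anti := wo_chain_antisymmetric (well_order_chain wo).
split=> [xb|->]; last exact: UpperCentral0.
case: b x / xb b0 => [//|a b x [/andP[ab /eqP nab] _] _|a b x [nb0] //] b0.
by case: nab; apply: anti => //; rewrite ab b0.
Qed.

Lemma upper_centralS (W : eqType) (le : rel W) (a b : W) (x : G) :
  well_order le -> wo_succ le a b ->
  upper_central le b x <-> forall y : G, upper_central le a [~ x, y]%g.
Proof.
move=> /well_order_chain wo sab.
have [anti tot] := (wo_chain_antisymmetric wo, wo_chainW wo).
split=> [xb|xa]; last exact: UpperCentralS sab xa.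
case: b x / xb sab => [b b0|a' b x sa'b xa'|a' b x [_ nsb] _ _] sab.
- by case: sab => /andP[ab /eqP[]]; apply: anti => //; rewrite ab b0.
- suff -> : a = a' by [].
  have lt_le c d : wo_succ le c b -> wo_succ le d b -> le c d.
    move=> [/andP[cb ncb] _] [_ hd]; have /orP[//|dc] := tot c d isT isT.
    have [-> //|ndc] := eqVneq d c; first by have /orP[] := tot c c isT isT.
    have bc : le b c by apply: hd; rewrite /wo_lt dc ndc.
    by case/eqP: ncb; apply: anti => //; rewrite cb bc.
  by apply: anti => //; rewrite !lt_le.
- by case: (nsb a).
Qed.

Lemma upper_centralL (W : eqType) (le : rel W) (b : W) (x : G) :
  wo_limit le b ->
  upper_central le b x <-> exists2 a, wo_lt le a b & upper_central le a x.
Proof.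
move=> lb; split=> [xb|[a ab xa]]; last exact: UpperCentralL lb ab xa.
case: b x / xb lb => [b b0|a b x sab _|a b x _ ab xa] lb.
- by case: lb.
- by case: lb => _ /(_ a).
- by exists a.
Qed.

Definition hypercenter (x : G) : Prop :=
  exists (W : eqType) (le : rel W) (b : W),
    well_order le /\ upper_central le b x.

Definition has_order (x : G) (n : nat) : Prop :=
  [/\ (0 < n)%N, (x ^+ n = 1)%g
    & forall m : nat, (0 < m < n)%N -> (x ^+ m <> 1)%g].

Definition is_2group (H : G -> Prop) : Prop :=
  forall x, H x -> exists k : nat, has_order x (2 ^ k)%N.

End UpperCentralSeries.

(* Main.v *)
Require Import Defs.
From mathcomp Require Import all_boot all_algebra.
From mathcomp Require Import finmap monalg.

(** Let [N] be the largest nil ideal of [RG]. A unit [u = e + b] that is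
    central modulo [N] makes [e] an idempotent unit modulo [N], so [e = 1] and
    [u - 1 = b] is nilpotent there; as [u - 1] is central modulo [N], it
    generates together with [N] a nil ideal, that is, [u - 1] lies in [N].
    This applies to [u = -1], so that [2] is nilpotent, and, by induction along
    the upper central series, to every hypercentral [x]: if [[x, y] - 1] lies
    in [N] for all [y], then [x] is central modulo [N]. Expanding [x - 1] to the
    power [2 ^ k] modulo [2] finally gives [x ^ (2 ^ k) = 1]. *)

Set Implicit Arguments.
Unset Strict Implicit.
Unset Printing Implicit Defensive.

Import GRing.Theory.
Local Open Scope ring_scope.

(** * Nil ideals, and units that are central modulo one *)

Section NilRadical.
Variable S : pzRingType.
Implicit Types (I J : S -> Prop) (a b e s u w : S).

Definition ideal I :=
  [/\ I 0, forall a b, I a -> I b -> I (a + b),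
      forall s a, I a -> I (s * a) & forall a s, I a -> I (a * s)].

Definition nil_ideal I := ideal I /\ forall a, I a -> nilpotent_elt a.

Definition nil_radical a := exists2 I, nil_ideal I & I a.

Lemma idealB I a b : ideal I -> I a -> I b -> I (a - b).
Proof.
by case=> _ ID IMl _ Ia Ib; apply: ID => //; rewrite -mulN1r; apply: IMl.
Qed.

Lemma ideal_congr I a b : ideal I -> I (a - b) -> I b -> I a.
Proof. by case=> _ ID _ _ Iab Ib; rewrite -(subrK b a); apply: ID. Qed.

Lemma ideal_congrX I a b n : ideal I -> I (a - b) -> I (a ^+ n - b ^+ n).
Proof.
move=> [I0 ID IMl IMr] Iab; elim: n => [|n IHn]; first by rewrite subrr.
rewrite !exprS; have -> : a * a ^+ n - b * b ^+ n =
    a * (a ^+ n - b ^+ n) + (a - b) * b ^+ n.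
  by rewrite mulrBr mulrBl addrA subrK.
by apply: ID; [apply: IMl | apply: IMr].
Qed.

Lemma ideal_exprMn I s w n : ideal I -> (forall t, I (w * t - t * w)) ->
  I ((s * w) ^+ n - s ^+ n * w ^+ n).
Proof.
move=> [I0 ID IMl IMr] wC.
elim: n => [|n IHn]; first by rewrite !expr0 mulr1 subrr.
have -> : (s * w) ^+ n.+1 - s ^+ n.+1 * w ^+ n.+1 =
    s * w * ((s * w) ^+ n - s ^+ n * w ^+ n)
    + s * (w * s ^+ n - s ^+ n * w) * w ^+ n.
  by rewrite !exprS !mulrBr mulrBl !mulrA addrA subrK.
by apply: ID; [apply: IMl | apply/IMr/IMl].
Qed.

Lemma nil_ideal_expr I a n : nil_ideal I -> I (a ^+ n) -> nilpotent_elt a.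
Proof. by move=> [_ Inil] /Inil[m am]; exists (n * m)%N; rewrite exprM. Qed.

Lemma nil_ideal_nil_radical : nil_ideal nil_radical.
Proof.
split; last by move=> a [I [_ Inil] /Inil].
split.
- exists (fun a => a = 0) => //.
  split=> [|a ->]; last by exists 1%N; rewrite expr1.
  by split=> [|a b -> ->|s a ->|a s ->] //; rewrite ?addr0 ?mulr0 ?mul0r.
- move=> a b [I nI Ia] [J nJ Jb].
  have [[[I0 ID IMl IMr] Inil] [[J0 JD JMl JMr] Jnil]] := (nI, nJ).
  (* The witness is [I + J]. It is nil: modulo [I] its elements agree with elements of [J], so some
     power of each falls into [I]. *)
  exists (fun c => exists2 d, J d & I (c - d)); last by exists b; rewrite ?addrK.
  split; last first.
    move=> c [d /Jnil[n dn0] Icd]; apply: (@nil_ideal_expr I _ n) => //.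
    by rewrite -[c ^+ n]subr0 -dn0; apply: ideal_congrX => //; case: nI.
  split.
  + by exists 0; rewrite ?subr0.
  + move=> c c' [d Jd Icd] [d' Jd' Icd']; exists (d + d'); first exact: JD.
    by rewrite opprD addrACA; apply: ID.
  + move=> s c [d Jd Icd]; exists (s * d); first exact: JMl.
    by rewrite -mulrBr; apply: IMl.
  + move=> c s [d Jd Icd]; exists (d * s); first exact: JMr.
    by rewrite -mulrBl; apply: IMr.
- move=> s a [I nI Ia]; exists I => //.
  by have [[_ _ IMl _] _] := nI; apply: IMl.
- move=> a s [I nI Ia]; exists I => //.
  by have [[_ _ _ IMr] _] := nI; apply: IMr.
Qed.

(** The complement [f = 1 - e] kills [e], so [f * u = f * b]. Iterating modulo [I] turns
    [f * u ^+ n] into [f * b ^+ n = 0]; cancelling the unit leaves [f] in [I], whence [u - 1] is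
    congruent to [b]. *)
Lemma nil_clean_unit_unipotent I u : ideal I -> is_unit u -> nil_clean u ->
  (forall s, I (u * s - s * u)) -> exists n, I ((u - 1) ^+ n).
Proof.
move=> idI [v [vu uv]] [e [b [ee [n bn0] def_u]]] uC.
have [I0 ID IMl IMr] := idI; exists n.
have eeE : e * e = e by rewrite -expr2.
have [f fE] : exists f, f = 1 - e by exists (1 - e).
have fuE : f * u = f * b by rewrite def_u mulrDr {1}fE mulrBl mul1r eeE subrr add0r.
have fuX m : I (f * u ^+ m - f * b ^+ m).
  elim: m => [|m IHm]; first by rewrite subrr.
  (* Centrality of [u] modulo [I] moves the new factor [u] leftwards past [b ^+ m], next to [f],
     where it becomes [b]. *)
  have -> : f * u ^+ m.+1 - f * b ^+ m.+1 =
      (f * u ^+ m - f * b ^+ m) * u - f * (u * b ^+ m - b ^+ m * u).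
    by rewrite mulrBl mulrBr opprB !mulrA fuE addrA subrK exprSr exprS !mulrA.
  by apply: idealB => //; [apply: IMr | apply: IMl].
have If : I f.
  have /(IMr _ (v ^+ n)) := fuX n; rewrite bn0 mulr0 subr0 -mulrA.
  by rewrite -exprMn_comm ?uv ?expr1n ?mulr1 // /GRing.comm uv vu.
have Iub : I (u - 1 - b).
  by rewrite def_u addrAC addrK -opprB -fE -mulN1r; apply: IMl.
by have := ideal_congrX n idI Iub; rewrite bn0 subr0.
Qed.

Lemma UNC_unit_subr1 u : UNC S -> is_unit u ->
  (forall s, nil_radical (u * s - s * u)) -> nil_radical (u - 1).
Proof.
move=> uncS Uu uC; have nN := nil_ideal_nil_radical.
have [[idN _] [N0 ND NMl NMr]] := (nN, nN.1).
have [n Nwn] := nil_clean_unit_unipotent idN Uu (uncS u Uu) uC.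
set w := u - 1 in Nwn *.
have wC s : nil_radical (w * s - s * w).
  by rewrite mulrBl mulrBr mul1r mulr1 opprB addrA subrK.
move: w Nwn wC => w Nwn wC.
(* This is [N + S w], with [N] the nil radical. Since [w] is central modulo [N], it absorbs products
   on the right, and [(s * w) ^+ n] is congruent to [s ^+ n * w ^+ n], which lies in [N]. *)
exists (fun c => exists s, nil_radical (c - s * w)); last first.
  by exists 1; rewrite mul1r subrr.
split; last first.
  move=> c [s Ncs]; apply: (@nil_ideal_expr nil_radical _ n) => //.
  apply: (ideal_congr idN (ideal_congrX n idN Ncs)).
  by apply: (ideal_congr idN (ideal_exprMn s n idN wC)); apply: NMl.
split.
- by exists 0; rewrite mul0r subrr.
- move=> c c' [s Ncs] [s' Ncs']; exists (s + s').
  by rewrite mulrDl opprD addrACA; apply: ND.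
- move=> t c [s Ncs]; exists (t * s).
  by rewrite -mulrA -mulrBr; apply: NMl.
- move=> c t [s Ncs]; exists (s * t).
  have -> : c * t - s * t * w = (c - s * w) * t + s * (w * t - t * w).
    by rewrite mulrBl mulrBr !mulrA addrA subrK.
  by apply: ND; [apply: NMr | apply: NMl].
Qed.

Lemma UNC_nilpotent2 : UNC S -> nilpotent_elt (2%:R : S).
Proof.
move=> uncS; have [idN Nnil] := nil_ideal_nil_radical; apply: Nnil.
have [N0 _ NMl _] := idN.
suff /(NMl (-1)) : nil_radical (-1 - 1) by rewrite -opprD mulrNN mul1r.
apply: UNC_unit_subr1 => // [|s]; first by exists (-1); rewrite mulrNN mulr1.
by rewrite mulN1r mulrN1 subrr.
Qed.

Lemma exprB1_2X w k : exists s, (w - 1) ^+ (2 ^ k) = w ^+ (2 ^ k) - 1 + s *+ 2.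
Proof.
elim: k => [|k [s IHk]]; first by exists 0; rewrite mul0rn addr0.
rewrite expnSr !exprM IHk; set a := w ^+ _; set T := s *+ 2.
(* Half of the error after squaring [(a - 1) + T]: [1 - a] comes from [(a - 1) ^+ 2], the other
   terms from the products involving [T = s *+ 2]. *)
exists (1 - a + ((a - 1) * s + (s * (a - 1) + s * T))).
have sqr_a : (a - 1) * (a - 1) = a * a - 1 + (1 - a) *+ 2.
  by rewrite mulrBl !mulrBr !mul1r !mulr1 mulr2n opprB !addrA subrK.
have -> A : (A + T) ^+ 2 = A * A + (A * T + (T * A + T * T)).
  by rewrite expr2 mulrDl !mulrDr !addrA.
have TE z : T * z = (s * z) *+ 2 by rewrite mulrnAl.
have ET z : z * T = (z * s) *+ 2 by rewrite mulrnAr.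
by rewrite sqr_a expr2 ET !TE -!mulrnDl -addrA -mulrnDl.
Qed.

End NilRadical.

(** The least positive exponent killing [x] divides [2 ^ k], since a nonzero remainder would be a
    smaller one. *)
Lemma has_order_2power (G : groupType) (x : G) k :
  (x ^+ (2 ^ k) = 1)%g -> exists j, has_order x (2 ^ j)%N.
Proof.
move=> xk; pose P n := (0 < n)%N && (x ^+ n == 1)%g.
have exP : exists n, P n by exists (2 ^ k)%N; rewrite /P expn_gt0 xk eqxx.
have [d /andP[d_gt0 /eqP xd] d_min] := ex_minnP exP.
suff /dvdn_pfactor-/(_ isT)[j _ dE] : (d %| 2 ^ k)%N.
  exists j; split; rewrite -?dE // => m /andP[m_gt0 m_lt] xm.
  by have := d_min m; rewrite /P m_gt0 xm eqxx leqNgt m_lt => /(_ isT).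
apply: contraT => nd; have /d_min : P (2 ^ k %% d)%N; last first.
  by rewrite leqNgt ltn_pmod.
rewrite /P lt0n nd /= -xk {2}(divn_eq (2 ^ k) d) expgnDr mulnC expgnA xd.
by rewrite expg1n mul1g.
Qed.

(** * Augmentation and group elements as units of the group ring *)

Section GroupRingUnits.
Variables (R : nzRingType) (G : groupType).
Implicit Types (g : group_ring R G) (c : R) (k x y : G).

Definition gr_basis c k : group_ring R G := << c *g k >>.

Lemma gr_basisM c1 c2 k1 k2 :
  gr_basis c1 k1 * gr_basis c2 k2 = gr_basis (c1 * c2) (k1 * k2)%g.
Proof. exact: gr_mulUU. Qed.

Lemma gr_basisE g :
  g = \sum_(k <- msupp (g : {malg R[G]})) gr_basis (mcoeff k g) k.
Proof. exact: monalgE. Qed.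

Lemma gr_basis_unit k : is_unit (gr_basis 1 k).
Proof.
by exists (gr_basis 1 k^-1%g); rewrite !gr_basisM mulr1 mulVg mulgV.
Qed.

Lemma gr_basisX k n : gr_basis 1 k ^+ n = gr_basis 1 (k ^+ n)%g.
Proof.
by elim: n => [|n IHn] //; rewrite exprS IHn gr_basisM mulr1 expgS.
Qed.

(** The augmentation, summing all coefficients; it carries nil-clean decompositions from [RG] to
    [R]. *)
Definition gr_aug g : R :=
  mmap (idfun : {additive R -> R}) (fun=> 1) (g : {malg R[G]}).

Lemma gr_augD : {morph gr_aug : g1 g2 / g1 + g2}.
Proof. by move=> g1 g2; rewrite /gr_aug -raddfD. Qed.

Lemma gr_aug_basis c k : gr_aug (gr_basis c k) = c.
Proof. by rewrite /gr_aug mmapU /= mulr1. Qed.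

Lemma gr_augM : {morph gr_aug : g1 g2 / g1 * g2}.
Proof.
have aug_sum (r : seq G) (F : G -> group_ring R G) :
    gr_aug (\sum_(k <- r) F k) = \sum_(k <- r) gr_aug (F k).
  by apply: big_morph; [exact: gr_augD | rewrite /gr_aug raddf0].
move=> g1 g2; rewrite [g1]gr_basisE [g2]gr_basisE mulr_suml !aug_sum mulr_suml.
apply: eq_bigr => k1 _; rewrite mulr_sumr aug_sum mulr_sumr.
by apply: eq_bigr => k2 _; rewrite gr_basisM !gr_aug_basis.
Qed.

Lemma UNC_group_ring_base : UNC (group_ring R G) -> UNC R.
Proof.
move=> uncRG u [v [vu uv]].
have aug1 : gr_aug 1 = 1 := gr_aug_basis 1 1%g.
have augX g n : gr_aug (g ^+ n) = gr_aug g ^+ n.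
  by elim: n => [|n IHn]; rewrite ?expr0 // !exprS gr_augM IHn.
have [|e [b [ee [n bn0] uE]]] := uncRG (gr_basis u 1%g).
  by exists (gr_basis v 1%g); rewrite !gr_basisM vu uv mulg1.
exists (gr_aug e), (gr_aug b); split.
- by rewrite /idempotent_elt -augX ee.
- exists n; rewrite -augX bn0.
  by apply: (addrI (gr_aug 0)); rewrite -gr_augD !addr0.
- by rewrite -gr_augD -uE gr_aug_basis.
Qed.

Lemma gr_basis_central (I : group_ring R G -> Prop) x : ideal I ->
  (forall y, I (gr_basis 1 [~ x, y]%g - 1)) ->
  forall g, I (gr_basis 1 x * g - g * gr_basis 1 x).
Proof.
move=> [I0 ID IMl _] xC g; rewrite (gr_basisE g) mulr_sumr mulr_suml -sumrB.
elim/big_ind: _ => // k _.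
set c := mcoeff k g.
(* In the group, [x k = k x [x, k]], and the coefficient [c] commutes with group elements. *)
have -> : gr_basis 1 x * gr_basis c k - gr_basis c k * gr_basis 1 x
    = gr_basis c (k * x)%g * (gr_basis 1 [~ x, k]%g - 1).
  rewrite mulrBr mulr1 !gr_basisM !mulr1 mul1r; congr (gr_basis _ _ - _).
  by rewrite /commg /conjg !mulgA mulgK mulgV mul1g.
exact: IMl.
Qed.

Lemma upper_central_nil_radical (W : eqType) (le : rel W) (b : W) x :
  UNC (group_ring R G) -> upper_central le b x ->
  nil_radical (gr_basis 1 x - 1).
Proof.
move=> uncRG; have [idN _] := nil_ideal_nil_radical (group_ring R G).
(* At a zero stage [x = 1]; at a limit stage the induction hypothesis is the goal. The successor
   stage remains. *)
elim=> {b x} [b _|a b x _ _ IHx|] //; first by rewrite subrr; case: idN.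
apply: UNC_unit_subr1 (gr_basis_unit x) _ => //.
exact: gr_basis_central.
Qed.

Lemma unipotent_2power x : nilpotent_elt (2%:R : R) ->
  nilpotent_elt (gr_basis 1 x - 1) -> exists n : nat, (x ^+ (2 ^ n) = 1)%g.
Proof.
move=> [m two_m] [n xn]; exists n.
have [s] := exprB1_2X (gr_basis 1 x) n; rewrite gr_basisX.
(* As [n < 2 ^ n], the power [2 ^ n] of [gr_basis 1 x - 1] vanishes too. The coefficients at the
   identity are then compared. *)
rewrite -(subnK (ltnW (ltn_expl n (isT : 1 < 2)%N))) exprD xn mulr0.
rewrite subnK ?(ltnW (ltn_expl _ _)) // => /(congr1 (mcoeff 1%g)).
rewrite mcoeff0 mcoeffD mcoeffB mcoeffMn mcoeffUU mcoeffU.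
have [//|x2n] := eqVneq; set r := mcoeff _ _ => /eqP.
(* If [x ^+ (2 ^ n)] were not the identity, the comparison would give [1 = r *+ 2], making [1]
   nilpotent along with [2]. *)
rewrite mulr0n sub0r addrC eq_sym subr_eq0 => /eqP r2.
have := oner_eq0 R; rewrite -(expr1n R m) -r2 -mulr_natr exprMn_comm.
  by rewrite two_m mulr0 eqxx.
exact: commr_nat.
Qed.

End GroupRingUnits.

Theorem theorem2p20 (R : nzRingType) (G : groupType) :
  UNC (group_ring R G) -> UNC R /\ is_2group (@hypercenter G).
Proof.
move=> uncRG; have uncR := UNC_group_ring_base uncRG.
split=> // x [W [le [b [_ xb]]]].
have [_ Nnil] := nil_ideal_nil_radical (group_ring R G).
have /Nnil := upper_central_nil_radical uncRG xb.
by move=> /(unipotent_2power (UNC_nilpotent2 uncR))[k /has_order_2power].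
Qed.
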